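(* Let $X\subseteq\overline X$ and $Y\subseteq\overline Y$ be objects of $\mathcal S_p$. Let $\varphi\colon\partial X\to\partial Y$ be a continuous map. If the boundary $\partial Y$ is metrisable, then there is a morphism $F\colon X\to Y$ in $\mathcal S_p$ with boundary values $\varphi$, and any two such morphisms are close. The map $F$ is coarse with respect to the coarse structures on $X$ and $Y$ defined by the compactifications $\overline X$ and $\overline Y$.
   Context: All spaces are Hausdorff. A compactification of a locally compact space $X$ is a compact space $\overline X$ with a homeomorphism from $X$ onto a dense open subset of $\overline X$; $\partial X:=\overline X\setminus X$. The category $\mathcal S$: objects are compactified spaces $X\subseteq\overline X$ with $X$ $\sigma$-compact and locally compact. A morphism from $X\subseteq\overline X$ to $Y\subseteq\overline Y$ is a map $\overline F\colon\overline X\to\overline Y$ with $\overline F(X)\subseteq Y$ and $\overline F(\partial X)\subseteq\partial Y$ that is continuous at all points of $\partial X$ (not necessarily on $X$). It is determined by $F:=\overline F|_X\colon X\to Y$; its boundary values are $\partial F:=\overline F|_{\partial X}\colon\partial X\to\partial Y$. Two morphisms are close if they induce the same map $\partial X\to\partial Y$. $\mathcal S_p\subseteq\mathcal S$ is the full subcategory of those compactified spaces for which the subsets $\{(x,x)\mid x\in X\}$ and $\{(x,y)\in\overline X\times\overline X\mid x\ne y\text{ and }(x\in\partial X\text{ or }y\in\partial X)\}$ of $\overline X\times\overline X$ are contained in disjoint open subsets of $\overline X\times\overline X$. Coarse structure of a compactification: $E\subseteq X\times X$ is controlled if, whenever a net $(x_i,y_i)$ in $E$ converges in $\overline X\times\overline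 X$ with $\lim x_i\in\partial X$ or $\lim y_i\in\partial X$, then $\lim x_i=\lim y_i$. Its bounded subsets are exactly the relatively compact ones. A map $F\colon X\to Y$ (not necessarily continuous) is coarse if it is proper (preimages of bounded subsets are bounded) and $(F\times F)(E)$ is controlled for every controlled $E$. *)

(* Defs.v *)
From HB Require Import structures.
From mathcomp Require Import all_boot all_order all_algebra.
From mathcomp Require Import all_classical all_reals all_analysis.

Set Implicit Arguments.
Unset Strict Implicit.
Unset Printing Implicit Defensive.

Local Open Scope classical_set_scope.

Definition sigma_compact (T : topologicalType) : Prop :=
  exists K : nat -> set T,
    (forall n, compact (K n)) /\ \bigcup_n K n = [set: T].

Definition metrizable (R : realType) (T : topologicalType) : Prop :=
  exists (M : metricType R) (f : T -> M) (g : M -> T),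
    [/\ cancel f g, cancel g f, continuous f & continuous g].

(* An object of the category S.  The space X is the subset [cinner] of the
   compactification [cbar]; the topology on the type [set_type cinner] is the
   subspace topology. *)
Record compactified := Compactified {
  cbar : topologicalType ;
  cinner : set cbar ;
  cbar_hausdorff : hausdorff_space cbar ;
  cbar_compact : compact [set: cbar] ;
  cinner_open : open cinner ;
  cinner_dense : dense cinner ;
  cinner_locally_compact : locally_compact [set: set_type cinner] ;
  cinner_sigma_compact : sigma_compact (set_type cinner)
}.
Arguments cinner : clear implicits.

Definition cbd (X : compactified) : set (cbar X) := ~` cinner X.
Arguments cbd : clear implicits.

Notation inner X := (set_type (cinner X)).
Notation boundary X := (set_type (cbd X)).

(* Membership in S_p.  As S_p is a full subcategory, its morphisms are the
   morphisms of S between such objects. *)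
Definition in_Sp (X : compactified) : Prop :=
  exists U V : set (cbar X * cbar X),
    [/\ open U, open V, U `&` V = set0,
        [set (x, x) | x in cinner X] `<=` U &
        [set p | p.1 <> p.2 /\ (cbd X p.1 \/ cbd X p.2)] `<=` V].

Record morphism (X Y : compactified) := Morphism {
  mbar :> cbar X -> cbar Y ;
  mbar_inner : forall x, cinner X x -> cinner Y (mbar x) ;
  mbar_bd : forall x, cbd X x -> cbd Y (mbar x) ;
  mbar_cont : forall x, cbd X x -> {for x, continuous mbar}
}.
Arguments mbar_inner {X Y} m {x}.
Arguments mbar_bd {X Y} m {x}.

Definition inner_map (X Y : compactified) (F : morphism X Y) :
    inner X -> inner Y :=
  fun x => SigSub (mem_set (mbar_inner F (set_mem (valP x)))).

Definition boundary_values (X Y : compactified) (F : morphism X Y) :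
    boundary X -> boundary Y :=
  fun x => SigSub (mem_set (mbar_bd F (set_mem (valP x)))).

Definition close_morphisms (X Y : compactified) (F G : morphism X Y) : Prop :=
  boundary_values F =1 boundary_values G.

Definition directed (I : Type) (le : I -> I -> Prop) : Prop :=
  [/\ inhabited I,
      forall i, le i i,
      forall i j k, le i j -> le j k -> le i k &
      forall i j, exists k, le i k /\ le j k].

Definition net_cvg (I : Type) (le : I -> I -> Prop) (T : topologicalType)
    (u : I -> T) (l : T) : Prop :=
  forall U : set T, nbhs l U -> exists i0, forall i, le i0 i -> U (u i).

Definition controlled (X : compactified) (E : set (inner X * inner X)) : Prop :=
  forall (I : Type) (le : I -> I -> Prop) (u v : I -> inner X) (a b : cbar X),
    directed le ->
    (forall i, E (u i, v i)) ->
    net_cvg le (fun i => (\val (u i), \val (v i)) : cbar X * cbar X) (a, b) ->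
    cbd X a \/ cbd X b -> a = b.

(* The bounded subsets of the coarse structure of a compactification are the
   relatively compact subsets of X; [precompact] is relative to the space X
   itself, not to [cbar X]. *)
Definition bounded_subset (X : compactified) (B : set (inner X)) : Prop :=
  precompact B.

Definition coarse_map (X Y : compactified) (f : inner X -> inner Y) : Prop :=
  (forall B, bounded_subset B -> bounded_subset (f @^-1` B)) /\
  (forall E, controlled E ->
     controlled [set (f p.1, f p.2) | p in E]).

(* Main.v *)
Require Import Defs.
From HB Require Import structures.
From mathcomp Require Import all_boot all_order all_algebra.
From mathcomp Require Import all_classical all_reals all_analysis.

(** Why a continuous [phi] between the boundaries extends.  Let [G] be the graph
of [phi], a compact subset of [cbar X * cbar Y].  Its complement is a countable
union of compact sets ([setC_boundary_graph_Fsigma]): the points over X or over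
Y are covered because X and Y are sigma-compact, and the remaining pairs of
boundary points (x, y) with phi x <> y are covered because the off-diagonal of
a metric space is a countable union of closed sets.  In a compact Hausdorff
space this gives [G] a countable decreasing neighbourhood basis [W n]
([nbhs_basis_of_closed_Gdelta]), with [W 0] the whole space.

As Y is dense, for each [n] the slices { x | W n (x, y) }, y in Y, cover the
boundary of X; by compactness finitely many points y suffice.  For x in X let
[n] be the largest index for which x lies in one of the chosen slices, and let
[F x] be the corresponding y ([locally_finite_selection]).  When x tends to a
boundary point, [n] tends to infinity, so (x, F x) is absorbed by every
neighbourhood of [G] and [F x] tends to the value of [phi].  Near a point of X
the index [n] stays bounded, because [G] lies over the boundary; hence [F]
takes finitely many values there.

This local boundedness is what makes [F] coarse: continuity at the boundary
alone puts no restriction on the images of compact subsets of X.  Given a net in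
the image of a controlled set E whose limit (a, b) meets the boundary, a cluster
point (c, d) of the net of preimages in E cannot lie in X times X, by local
boundedness.  So c = d is a boundary point since E is controlled, and
continuity of [F] there yields a = b ([locally_bounded_controlled]).

Uniqueness up to closeness is immediate, close morphisms being those with equal
boundary values. *)

Set Implicit Arguments.
Unset Strict Implicit.
Unset Printing Implicit Defensive.

Import Order.TTheory GRing.Theory Num.Theory.

Local Open Scope classical_set_scope.

(** * Topological preliminaries *)

Lemma continuous_map_pair (S S' T T' : topologicalType) (f : S -> S')
    (g : T -> T') :
  continuous f -> continuous g ->
  continuous (fun p : S * T => (f p.1, g p.2)).
Proof.
move=> cf cg [x y]; apply: cvg_pair.
  by apply: (@cvg_comp _ _ _ fst f _ (nbhs x)); [exact: cvg_fst|exact: cf].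
by apply: (@cvg_comp _ _ _ snd g _ (nbhs y)); [exact: cvg_snd|exact: cg].
Qed.

Lemma closed_setX (S T : topologicalType) (A : set S) (B : set T) :
  closed A -> closed B -> closed (A `*` B).
Proof.
move=> cA cB; rewrite (_ : A `*` B = fst @^-1` A `&` snd @^-1` B) //.
by apply: closedI; apply: preimage_closed => // -[x y] _;
  [exact: cvg_fst|exact: cvg_snd].
Qed.

Lemma hausdorff_setX (S T : topologicalType) :
  hausdorff_space S -> hausdorff_space T -> hausdorff_space (S * T)%type.
Proof.
move=> hS hT [a b] [c d] cl; congr pair.
  apply: hS => U V aU cV; have [||[s t] [/= Us Vs]] := cl (U `*` setT) (V `*` setT).
  - by exists (U, setT) => //; split=> //; exact: filterT.
  - by exists (V, setT) => //; split=> //; exact: filterT.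
  by exists s; split; [case: Us|case: Vs].
apply: hT => U V bU dV; have [||[s t] [/= Us Vs]] := cl (setT `*` U) (setT `*` V).
- by exists (setT, U) => //; split=> //; exact: filterT.
- by exists (setT, V) => //; split=> //; exact: filterT.
by exists t; split; [case: Us|case: Vs].
Qed.

Lemma compact_set_val_preimage (T : topologicalType) (A K : set T) :
  compact K -> K `<=` A -> compact (@set_val T A @^-1` K).
Proof.
move=> cK KA F PF FK.
have [x [Kx clx]] := cK (set_val @ F) _ FK.
exists (SigSub (mem_set (KA _ Kx))); split => // P Q FP.
rewrite nbhsE => -[_ [[V oV <-] Vx] VQ].
have FP' : (set_val @ F) (set_val @` P).
  by rewrite /= nbhs_simpl; apply: filterS FP => z Pz; exists z.
have [_ [[z Pz <-] Vz]] := clx _ V FP' (open_nbhs_nbhs (conj oV Vx)).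
by exists z; split=> //; exact: VQ.
Qed.

Lemma offdiagonal_Fsigma (R : realType) (M : metricType R) :
  exists C : nat -> set (M * M),
    (forall n, closed (C n)) /\ \bigcup_n C n = [set p | p.1 <> p.2].
Proof.
pose E n := [set p : M * M | ball p.1 (n.+1%:R^-1 : R)%R p.2].
(* interiors, because the [E n] are only neighbourhoods of the diagonal *)
exists (fun n => ~` (E n)°); split=> [n|].
  exact/open_closedC/open_interior.
apply/seteqP; split=> [[a b] [n _ /= nE] ab|[a b] /= ab].
  apply: nE; rewrite ab /interior /E.
  have r0 : (0 < (n.+1%:R^-1 / 2 : R))%R by rewrite divr_gt0.
  exists (ball b (n.+1%:R^-1 / 2 : R)%R, ball b (n.+1%:R^-1 / 2 : R)%R).
    by split; exact: nbhsx_ballx.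
  move=> [z w] /= [bz bw]; rewrite (splitr n.+1%:R^-1)%R.
  by apply: ball_triangle bw; exact: ball_sym.
apply: contrapT => nC; apply: ab; apply: mdist_positivity.
apply/eqP; rewrite eq_le mdist_ge0 andbT.
apply/ler_addgt0Pl => /= e e0; rewrite addr0.
have [n ne] : exists n, (n.+1%:R^-1 < e :> R)%R.
  have [n _ /(_ n (leqnn _)) ] := near_infty_natSinv_lt (PosNum e0).
  by exists n.
have : E n (a, b).
  apply: contrapT => nE; apply: nC; exists n => //= /interior_subset; exact: nE.
rewrite /E /= ballEmdist /= => ab; apply: ltW.
exact: lt_trans ne.
Qed.

(** A closed Gdelta in a compact Hausdorff space has a countable neighbourhood
basis: by normality it has open neighbourhoods whose closures avoid the [C n]
one at a time, and their finite intersections converge to it.  The basis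
property is stated for a closed set D disjoint from G, the complement of an open
neighbourhood. *)
Lemma nbhs_basis_of_closed_Gdelta (T : topologicalType) (G : set T)
    (C : nat -> set T) :
  hausdorff_space T -> compact [set: T] -> closed G ->
  (forall n, closed (C n)) -> ~` G = \bigcup_n C n ->
  exists W : nat -> set T,
    [/\ W 0%N = setT, forall n, open (W n), forall n, G `<=` W n,
        forall m n, (m <= n)%N -> W n `<=` W m
      & forall D, closed D -> D `<=` ~` G ->
          exists n, forall x, D x -> ~ W n x].
Proof.
move=> hT cT cG cC GC.
have sep n : exists N : set T, [/\ open N, G `<=` N & closure N `<=` ~` C n].
  have nGC : set_nbhs G (~` C n).
    apply/set_nbhsP; exists (~` C n); split=> //; first exact: closed_openC.
    by apply: subsetCr; rewrite GC; exact: bigcup_sup.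
  have [N /set_nbhsP [N' [oN' GN' N'N]] NC] := compact_normal hT cT cG nGC.
  by exists N'; split=> //; apply: subset_trans NC; exact: closureS.
have [N HN] := choice sep.
(* intersecting over [i < n] makes the first member the whole space *)
exists (fun n => \bigcap_(i in `I_n) N i); split.
- by rewrite II0 bigcap_set0.
- move=> n; rewrite bigcap_mkord.
  by elim/big_ind: _ => [|A B|i _]; [exact: openT|exact: openI|case: (HN i)].
- by move=> n x Gx i _; have [_ + _] := HN i; exact.
- by move=> m n mn x Wx i im; apply: Wx; exact: leq_trans mn.
move=> D cD DG.
(* a point of D lies in some [C n], hence off the closure of [N n]; so D is
   covered by open sets each of which misses [W m] for all large [m] *)
have /compact_near_coveringP cptD : compact D by exact: (subclosed_compact cD cT).
have [|M _ /(_ M (leqnn M)) DM] :=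
    cptD nat \oo (fun n x => ~ (\bigcap_(i in `I_n) N i) x) _.
  move=> x /DG; rewrite GC => -[n _ Cnx].
  have [oN _ clN] := HN n.
  exists (~` closure (N n), [set m | n < m]%N); first split=> /=.
  - apply: open_nbhs_nbhs; split; first exact/closed_openC/closed_closure.
    by move=> /clN.
  - by exists n.+1.
  move=> [z m] /= [zN nm] /(_ n nm) Nz; apply: zN; exact: subset_closure.
by exists M.
Qed.

(** * Selecting values near the graph *)

Lemma finite_slice_cover (S T : topologicalType) (A : set S) (B : set T)
    (G W : set (S * T)) :
  compact A -> dense B -> open W -> G `<=` W ->
  (forall x, A x -> exists y, G (x, y)) ->
  exists F : set T, [/\ finite_set F, F `<=` B &
    forall x, A x -> exists2 y, F y & W (x, y)].
Proof.
move=> /compact_near_coveringP cA dB oW GW AG.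
(* the eventual subsets of B, along which compactness of A is applied: a
   slice that covers a neighbourhood survives when the subset grows *)
pose FF := filter_from [set F : set T | finite_set F /\ F `<=` B]
  (fun F => [set F' | F `<=` F']).
have fFF : Filter FF.
  apply: filter_from_filter; first by exists set0; split.
  move=> F1 F2 [fF1 FB1] [fF2 FB2]; exists (F1 `|` F2); last first.
    by move=> F /=; rewrite subUset.
  by split; [rewrite finite_setU|rewrite subUset].
have [|F [fF FB] /(_ F) FA] :=
    cA _ FF (fun F x => exists2 y, F y & W (x, y)) fFF.
  move=> x /AG [y Gxy].
  have : nbhs (x, y) W by apply: open_nbhs_nbhs; split=> //; exact: GW.
  case=> -[N1 N2] /= [N1x]; rewrite nbhsE => -[U [oU Uy] UN] NW.
  have [y' [Uy' By']] := dB U (ex_intro _ y Uy) oU.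
  exists (N1, [set F' | F' y']); first split=> //=.
    exists [set y'] => /=; last by move=> F' /(_ y' erefl).
    by split; [exact: finite_set1|move=> _ ->].
  move=> [z F] /= [N1z Fy']; exists y' => //.
  by apply: NW; split=> //=; exact: UN.
by exists F; split=> //; exact: FA.
Qed.

(** Follow the [W n] as far as a finite choice of values allows.  Off A the index
of the deepest usable [W n] is finite, since G lies over A; it tends to infinity
at A, so that (z, f z) enters every [W n], and it is bounded near each point off
A, so that [f] takes finitely many values there. *)
Lemma locally_finite_selection (S T : topologicalType) (A : set S) (B : set T)
    (G : set (S * T)) (W : nat -> set (S * T)) :
  compact A -> dense B -> B !=set0 ->
  (forall x, A x -> exists y, G (x, y)) ->
  W 0%N = setT -> (forall n, open (W n)) -> (forall n, G `<=` W n) ->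
  (forall m n, (m <= n)%N -> W n `<=` W m) ->
  (forall x, ~ A x -> exists n, \forall z \near x, forall y, ~ W n (z, y)) ->
  exists f : S -> T,
    [/\ forall x, B (f x),
        forall n x, A x -> \forall z \near x, ~ A z -> W n (z, f z)
      & forall x, ~ A x -> exists F : set T,
          [/\ finite_set F, F `<=` B & \forall z \near x, ~ A z -> F (f z)]].
Proof.
move=> cA dB [y0 By0] AG W0 oW GW decW farW.
have [F HF] := choice (fun n => finite_slice_cover cA dB (oW n) (GW n) AG).
(* adding [y0] makes the index 0 admissible at every point, as [W 0 = setT] *)
pose F' n := F n `|` [set y0].
have F'fin n : finite_set (F' n).
  by rewrite finite_setU; split; [case: (HF n)|exact: finite_set1].
have F'B n : F' n `<=` B by rewrite subUset; split; [case: (HF n)|move=> _ ->].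
pose P x n := exists2 y, F' n y & W n (x, y).
have sel x : exists y, B y /\ (~ A x -> exists n,
    [/\ F' n y, W n (x, y) & forall m, P x m -> (m <= n)%N]).
  have [Ax|nAx] := pselect (A x); first by exists y0; split.
  have [N /nbhs_singleton farN] := farW x nAx.
  have P0 : exists n, `[< P x n >].
    by exists 0%N; apply/asboolP; exists y0; [right|rewrite W0].
  have Pbd n : `[< P x n >] -> (n <= N)%N.
    move=> /asboolP [y _ Wy]; rewrite leqNgt; apply/negP => Nn.
    by apply: (farN y); apply: decW Wy; exact: ltnW.
  case: (ex_maxnP P0 Pbd) => n /asboolP [y F'y Wy] nmax.
  exists y; split; first exact: F'B F'y.
  by move=> _; exists n; split=> // m Pm; apply: nmax; exact/asboolP.
have [f Hf] := choice sel.
exists f; split=> [x|n x Ax|x nAx]; first by case: (Hf x).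
- have [_ _ /(_ x Ax) [y Fy Wy]] := HF n.
  have : nbhs (x, y) (W n) by exact: open_nbhs_nbhs.
  case=> -[N1 N2] /= [N1x /nbhs_singleton N2y] NW.
  apply: filterS N1x => z N1z nAz.
  have [_ /(_ nAz) [m [_ Wm mmax]]] := Hf z.
  apply: decW Wm; apply: mmax; exists y; first by left.
  by apply: NW.
have [N farN] := farW x nAx.
exists (\bigcup_(n in `I_N) F' n); split.
- by apply: bigcup_finite => //; exact: finite_II.
- by move=> y [n _]; exact: F'B.
apply: filterS farN => z farN nAz.
have [_ /(_ nAz) [m [Fm Wm _]]] := Hf z.
exists m => //=; rewrite ltnNge; apply/negP => Nm.
by apply: (farN (f z)); exact: decW Wm.
Qed.

(** * Compactifications and the graph of a boundary map *)

Lemma boundary_closed (X : compactified) : closed (cbd X).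
Proof. exact/open_closedC/cinner_open. Qed.

Lemma boundary_compact (X : compactified) : compact (cbd X).
Proof.
by apply: (subclosed_compact (@boundary_closed X) (@cbar_compact X)).
Qed.

Lemma compact_boundary_space (X : compactified) : compact [set: boundary X].
Proof.
rewrite (_ : setT = @set_val _ (cbd X) @^-1` cbd X).
  by apply: compact_set_val_preimage => //; exact: boundary_compact.
apply/seteqP; split=> // x _; exact: set_valP.
Qed.

Lemma inner_sigma_compact (X : compactified) :
  exists K : nat -> set (cbar X),
    (forall n, compact (K n)) /\ \bigcup_n K n = cinner X.
Proof.
have [K [cK KT]] := cinner_sigma_compact X.
exists (fun n => set_val @` K n); split=> [n|].
  apply: continuous_compact => //.
  by apply: continuous_subspaceT; exact: initial_continuous.
rewrite -image_bigcup KT; apply/seteqP; split=> [_ [x _ <-]|x Xx].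
  exact: set_valP.
by exists (SigSub (mem_set Xx)).
Qed.

Lemma closed_nbhs_sub (X : compactified) (x : cbar X) (U : set (cbar X)) :
  nbhs x U -> exists V, [/\ nbhs x V, closed V & V `<=` U].
Proof.
move=> xU.
have [V xV VU] :=
  compact_regular (@cbar_hausdorff X) (@cbar_compact X) (filterT : nbhs x setT) xU.
exists (closure V); split=> //; last exact: closed_closure.
by apply: filterS xV; exact: subset_closure.
Qed.

(** The graph is taken in the product of the compactifications rather than of
the boundaries, so that its neighbourhoods reach into X and Y. *)
Definition boundary_graph (X Y : compactified)
    (phi : boundary X -> boundary Y) : set (cbar X * cbar Y) :=
  [set (\val z, \val (phi z)) | z in [set: boundary X]].

Lemma boundary_graph_compact (X Y : compactified)
    (phi : boundary X -> boundary Y) :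
  continuous phi -> compact (boundary_graph phi).
Proof.
move=> cphi; apply: continuous_compact; last exact: compact_boundary_space.
apply: continuous_subspaceT => z; apply: cvg_pair.
- exact: (nbhs_filter z).
- exact: (@initial_continuous _ _ (@set_val _ (cbd X)) z).
apply: (@continuous_comp _ _ _ phi (@set_val _ (cbd Y))); first exact: cphi.
exact: initial_continuous.
Qed.

(** The place where metrisability of the boundary of Y and sigma-compactness of
X and Y enter: they make the graph a Gdelta. *)
Lemma setC_boundary_graph_Fsigma (R : realType) (X Y : compactified)
    (phi : boundary X -> boundary Y) :
  continuous phi -> metrizable R (boundary Y) ->
  exists C : nat -> set (cbar X * cbar Y),
    (forall n, compact (C n)) /\ ~` boundary_graph phi = \bigcup_n C n.
Proof.
move=> cphi [M [f [g [fK gK cf cg]]]].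
have [K [cK KX]] := inner_sigma_compact X.
have [L [cL LY]] := inner_sigma_compact Y.
have [D [cD DM]] := offdiagonal_Fsigma M.
pose h (p : boundary X * boundary Y) : M * M := (f (phi p.1), f p.2).
pose v (p : boundary X * boundary Y) : cbar X * cbar Y :=
  (\val p.1, \val p.2).
have ch : continuous h.
  apply: (@continuous_map_pair _ _ _ _ (f \o phi) f) => // x.
  by apply: continuous_comp; [exact: cphi|exact: cf].
have cv : continuous v.
  by apply: continuous_map_pair; exact: initial_continuous.
(* the points over X, the points over Y, and the pairs of boundary points
   whose images in M lie in the n-th closed piece of the off-diagonal *)
exists (fun n => K n `*` setT `|` setT `*` L n `|` v @` (h @^-1` D n)); split.
  move=> n; apply: compactU; first apply: compactU.
  - exact: compact_setX (cK n) (@cbar_compact Y).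
  - exact: compact_setX (@cbar_compact X) (cL n).
  apply: continuous_compact; first exact: continuous_subspaceT.
  apply: (@subclosed_compact _ _ setT) => //.
    by apply: preimage_closed => // p _; exact: ch.
  rewrite -setXTT.
  by apply: compact_setX; exact: compact_boundary_space.
apply/seteqP; split=> [[x y] nG|[x y] [n _ [[[Kx _]|[_ Ly]]|[p hp pv]]] [z _ zv]].
- have [Xx|nXx] := pselect (cinner X x).
    by move: Xx; rewrite -KX => -[n _ Kx]; exists n => //; left; left.
  have [Yy|nYy] := pselect (cinner Y y).
    by move: Yy; rewrite -LY => -[n _ Ly]; exists n => //; left; right.
  pose x' : boundary X := SigSub (mem_set (nXx : cbd X x)).
  pose y' : boundary Y := SigSub (mem_set (nYy : cbd Y y)).
  have : [set p | p.1 <> p.2] (h (x', y')).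
    move=> /= /(can_inj fK) xy; apply: nG; exists x' => //.
    by rewrite xy.
  by rewrite -DM => -[n _ hn]; exists n => //; right; exists (x', y').
- move: zv => [zx _]; have : cinner X x by rewrite -KX; exists n.
  by rewrite -zx; exact: (set_valP z).
- move: zv => [_ zy]; have : cinner Y y by rewrite -LY; exists n.
  by rewrite -zy; exact: (set_valP (phi z)).
have /= : [set p | p.1 <> p.2] (h p) by rewrite -DM; exists n.
move: zv pv => [<- <-] [/val_inj -> /val_inj ->]; exact.
Qed.

(** * Extension of boundary maps *)

(** Locally on X, the values stay away from the boundary of Y: a closed subset of
[cbar Y] inside [cinner Y] is a compact subset of Y. *)
Definition locally_bounded (X Y : compactified) (F : cbar X -> cbar Y) : Prop :=
  forall x, cinner X x -> exists K,
    [/\ closed K, K `<=` cinner Y & \forall z \near x, K (F z)].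

(** The selection is applied with A the boundary of X and B the space Y.  A
neighbourhood [W n] that avoids (closed neighbourhood of x) times (complement of
an open neighbourhood of phi x) gives continuity at x. *)
Lemma boundary_map_extends (R : realType) (X Y : compactified)
    (phi : boundary X -> boundary Y) :
  (cinner X !=set0 -> cinner Y !=set0) ->
  continuous phi -> metrizable R (boundary Y) ->
  exists F : morphism X Y, boundary_values F =1 phi /\ locally_bounded F.
Proof.
move=> hne cphi mY.
have [C [cC GC]] := setC_boundary_graph_Fsigma cphi mY.
have hXY := hausdorff_setX (@cbar_hausdorff X) (@cbar_hausdorff Y).
have cXY : compact [set: cbar X * cbar Y].
  by rewrite -setXTT; apply: compact_setX; exact: cbar_compact.
have [W [W0 oW GW decW sepW]] := nbhs_basis_of_closed_Gdelta hXY cXY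
  (compact_closed hXY (boundary_graph_compact cphi))
  (fun n => compact_closed hXY (cC n)) GC.
have farW x : ~ cbd X x ->
    exists n, \forall z \near x, forall y, ~ W n (z, y).
  move=> /contrapT Xx.
  have [|V [xV cV VX]] := @closed_nbhs_sub X x (cinner X).
    by apply: open_nbhs_nbhs; split => //; exact: cinner_open.
  have [|n WV] := sepW (V `*` setT) (closed_setX cV closedT).
    move=> [z y] /= [Vz _] [z' _ [zz' _]].
    have nXz : cbd X z by rewrite -zz'; exact: set_valP.
    by apply: nXz; exact: VX.
  by exists n; apply: filterS xV => z Vz y; exact: WV.
have [f [fB fbd fin]] : exists f : cbar X -> cbar Y,
    [/\ forall x, cinner Y (f x),
        forall n x, cbd X x -> \forall z \near x, ~ cbd X z -> W n (z, f z)
      & forall x, ~ cbd X x -> exists F : set (cbar Y),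
          [/\ finite_set F, F `<=` cinner Y
            & \forall z \near x, ~ cbd X z -> F (f z)]].
  (* an empty [cbar X] leaves [cinner Y] possibly empty *)
  have [[x _]|X0] := pselect ([set: cbar X] !=set0); last first.
    have nX (x : cbar X) : False by apply: X0; exists x.
    by exists (fun x => False_rect _ (nX x)); split=> [x|n x|x]; case: (nX x).
  apply: (locally_finite_selection (G := boundary_graph phi)) => //.
  - exact: boundary_compact.
  - exact: cinner_dense.
  - apply: hne.
    have [z [_ Xz]] := @cinner_dense X setT (ex_intro _ x I) openT.
    by exists z.
  - move=> z Xz; pose z' : boundary X := SigSub (mem_set Xz).
    by exists (\val (phi z')), z'.
pose F x := match pselect (cbd X x) with
  | left Xx => \val (phi (SigSub (mem_set Xx))) | right _ => f x end.
have Fbd (z : boundary X) : F (\val z) = \val (phi z).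
  rewrite /F; case: pselect => [Xz|]; last by have := set_valP z.
  by congr (\val (phi _)); exact: val_inj.
have Fin z : cinner X z -> F z = f z by rewrite /F; case: pselect.
have F1 x : cinner X x -> cinner Y (F x) by move=> /Fin ->.
have F2 x : cbd X x -> cbd Y (F x).
  move=> Xx; rewrite (Fbd (SigSub (mem_set Xx))); exact: set_valP.
have F3 x : cbd X x -> {for x, continuous F}.
  move=> Xx; pose x' : boundary X := SigSub (mem_set Xx).
  move=> U; rewrite [F x](Fbd x') nbhsE => -[U' [oU' U'x] U'U].
  have : nbhs x' ((fun z => \val (phi z)) @^-1` U').
    apply: (@continuous_comp _ _ _ phi (@set_val _ (cbd Y))).
    - exact: cphi.
    - exact: initial_continuous.
    - exact: open_nbhs_nbhs.
  rewrite nbhsE => -[_ [[V oV <-] Vx] VU'].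
  have [V' [xV' cV' V'V]] := closed_nbhs_sub (open_nbhs_nbhs (conj oV Vx)).
  (* over V', all pairs whose second component is outside U' are off the graph;
     so some W n confines the values near x to U' *)
  have [|n WV] := sepW (V' `*` ~` U') (closed_setX cV' (open_closedC oU')).
    move=> [z y] /= [V'z nU'y] [z' _ [zz' yz']]; apply: nU'y.
    by rewrite -yz'; apply: VU'; rewrite /= [set_val z']zz'; exact: V'V.
  rewrite /= nbhs_simpl; apply: filterS2 xV' (fbd n x Xx) => z V'z Wz; apply: U'U.
  have [Xz|nXz] := pselect (cbd X z).
    by rewrite (Fbd (SigSub (mem_set Xz))); apply: VU'; exact: V'V.
  rewrite Fin; last exact: contrapT.
  by apply: contrapT => nU'; apply: (WV (z, f z)) => //; exact: Wz.
exists (Morphism F1 F2 F3); split=> [z|x Xx].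
  by apply: val_inj => /=; exact: Fbd.
have [K [fK KY nK]] := fin x (fun nX => nX Xx).
exists K; split=> //=.
  exact: (accessible_finite_set_closed.1 (hausdorff_accessible (@cbar_hausdorff Y))).
have xX : nbhs x (cinner X).
  by apply: open_nbhs_nbhs; split=> //; exact: cinner_open.
by apply: filterS2 nK xX => z Kz Xz; rewrite Fin //; apply: Kz.
Qed.

(** * Coarseness *)

(** Otherwise the preimage of a compact set would accumulate at a boundary point,
whose image would then lie in that compact subset of Y. *)
Lemma morphism_proper (X Y : compactified) (F : morphism X Y) B :
  bounded_subset B -> bounded_subset (inner_map F @^-1` B).
Proof.
move=> [K BK [cK _]].
have cvK : closed (set_val @` K).
  apply: compact_closed; first exact: cbar_hausdorff.
  apply: continuous_compact => //; apply: continuous_subspaceT.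
  exact: initial_continuous.
pose Z := closure (set_val @` (inner_map F @^-1` B)).
have cZ : closed Z by exact: closed_closure.
have ZX : Z `<=` cinner X.
  move=> x Zx; apply: contrapT => nXx.
  have : nbhs (F x) (~` (set_val @` K)).
    apply: open_nbhs_nbhs; split; first exact: closed_openC.
    by move=> [y _ yFx]; apply: (mbar_bd F nXx); rewrite -yFx; exact: set_valP.
  move=> /(mbar_cont (m := F) nXx) /Zx [_ [[z Bz <-] /= nK]].
  by apply: nK; exists (inner_map F z) => //; exact: BK.
exists (set_val @^-1` Z); last split.
- by move=> z Bz /=; apply: subset_closure; exists z.
- apply: compact_set_val_preimage => //.
  exact: subclosed_compact cZ (@cbar_compact X) _.
- by apply: preimage_closed => // z _; exact: initial_continuous.
Qed.

(** Continuity at the boundary deals with nets of preimages that cluster at the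
boundary; local boundedness rules out that such nets cluster inside X while
their images tend to the boundary of Y. *)
Lemma locally_bounded_controlled (X Y : compactified) (F : morphism X Y) :
  locally_bounded F ->
  forall E, controlled E ->
    controlled [set (inner_map F p.1, inner_map F p.2) | p in E].
Proof.
move=> bF E cE I le u v a b [[i0] lexx letr ledir] Euv uv ab.
have /choice [p Hp] : forall i, exists q : inner X * inner X,
    E q /\ (inner_map F q.1, inner_map F q.2) = (u i, v i).
  by move=> i; have [q Eq quv] := Euv i; exists q.
pose q i : cbar X * cbar X := (\val (p i).1, \val (p i).2).
have Fq i : (F (q i).1, F (q i).2) = (\val (u i), \val (v i)).
  by have [_ [<- <-]] := Hp i.
pose tails := filter_from setT (fun i => [set q j | j in le i]).
have tailsP : ProperFilter tails.
  apply: filter_from_proper; last by move=> i _; exists (q i), i.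
  apply: filter_from_filter; first by exists i0.
  move=> i j _ _; have [k [ik jk]] := ledir i j; exists k => //.
  by move=> _ [l kl <-]; split; exists l => //; [apply: letr kl|apply: letr kl].
have cXX : compact [set: cbar X * cbar X].
  by rewrite -setXTT; apply: compact_setX; exact: cbar_compact.
have [[c d] [_ cld]] := cXX tails tailsP filterT.
have freq N i : nbhs (c, d) N -> exists2 j, le i j & N (q j).
  move=> cdN; have [|_ [[j ij <-] Nq]] := cld [set q j | j in le i] N _ cdN.
    by exists i.
  by exists j.
(* the net has limit (a, b) in [cbar Y * cbar Y], so conditions holding near
   (c, d) and near (a, b) are met at a common index *)
have meet N M : nbhs (c, d) N -> nbhs (a, b) M ->
    exists j, N (q j) /\ M (F (q j).1, F (q j).2).
  move=> cdN /uv [i iM]; have [j ij Nq] := freq N i cdN.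
  by exists j; split=> //; rewrite Fq; exact: iM.
have cX : cinner X c -> cinner Y a.
  move=> /bF [K [clK KY nK]]; apply: KY; apply: contrapT => nKa.
  have [||j [/= Kj /= nKj]] := meet ([set z | K (F z)] `*` setT) (~` K `*` setT).
  - by exists ([set z | K (F z)], setT) => //; split=> //; exact: filterT.
  - exists (~` K, setT) => //; split; last exact: filterT.
    by apply: open_nbhs_nbhs; split=> //; exact: closed_openC.
  by case: nKj => + _; apply; case: Kj.
have dX : cinner X d -> cinner Y b.
  move=> /bF [K [clK KY nK]]; apply: KY; apply: contrapT => nKb.
  have [||j [/= Kj /= nKj]] := meet (setT `*` [set z | K (F z)]) (setT `*` ~` K).
  - by exists (setT, [set z | K (F z)]) => //; split=> //; exact: filterT.
  - exists (setT, ~` K) => //; split; first exact: filterT.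
    by apply: open_nbhs_nbhs; split=> //; exact: closed_openC.
  by case: nKj => _; apply; case: Kj.
have cdbd : cbd X c \/ cbd X d.
  by case: ab => nY; [left=> /cX|right=> /dX].
have cd : c = d.
  (* the subnet converging to (c, d), indexed by pairs of an index and a
     neighbourhood of (c, d) that contains the corresponding term *)
  pose J := {j : I * set (cbar X * cbar X) | nbhs (c, d) j.2 /\ j.2 (q j.1)}.
  pose leJ (j k : J) := le (sval j).1 (sval k).1 /\ (sval k).2 `<=` (sval j).2.
  have mk i N : nbhs (c, d) N -> exists j : J, le i (sval j).1 /\ (sval j).2 = N.
    move=> cdN; have [j ij Nq] := freq N i cdN.
    by exists (exist _ (j, N) (conj cdN Nq)).
  apply: (cE J leJ (fun j => (p (sval j).1).1) (fun j => (p (sval j).1).2)) => //.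
  - split.
    + by have [j _] := mk i0 setT filterT; exists.
    + by move=> j; split.
    + by move=> j k l [jk kj] [kl lk]; split; [exact: letr kl|exact: subset_trans kj].
    move=> j k; have [i [ji ki]] := ledir (sval j).1 (sval k).1.
    have [|l [il lN]] := mk i ((sval j).2 `&` (sval k).2).
      by apply: filterI; [case: (svalP j)|case: (svalP k)].
    by exists l; split; (split; [exact: letr il|rewrite lN => z []]).
  - by move=> j; have [] := Hp (sval j).1; case: (p _).
  - move=> U cdU; have [j [_ jU]] := mk i0 U cdU; exists j => k [_].
    by rewrite jU; apply; case: (svalP k).
have bdc : cbd X c by case: cdbd => //; rewrite cd.
have Fc := mbar_cont (m := F) bdc.
have aF : a = F c.
  apply: (@cbar_hausdorff Y) => U V aU /Fc cV.
  have [||j [/= Vj /= Uj]] := meet (F @^-1` V `*` setT) (U `*` setT).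
  - by exists (F @^-1` V, setT) => //; split=> //; exact: filterT.
  - by exists (U, setT) => //; split=> //; exact: filterT.
  by exists (F (q j).1); split; [case: Uj|case: Vj].
rewrite aF; symmetry; apply: (@cbar_hausdorff Y) => U V bU /Fc cV.
have [||j [/= Vj /= Uj]] := meet (setT `*` F @^-1` V) (setT `*` U).
- by exists (setT, F @^-1` V) => //; split=> /=; [exact: filterT|rewrite -cd].
- by exists (setT, U) => //; split=> //; exact: filterT.
by exists (F (q j).2); split; [case: Uj|case: Vj].
Qed.

(** * The extension theorem *)

(* [hne] excludes the degenerate case in which Y is empty and X is a nonempty
   compact space: both boundaries are then empty, but there is no map from X
   to Y at all. *)
Theorem theorem8p1 (R : realType) (X Y : compactified)
    (hX : in_Sp X) (hY : in_Sp Y)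
    (hne : cinner X !=set0 -> cinner Y !=set0)
    (phi : boundary X -> boundary Y) (hphi : continuous phi)
    (hmetr : metrizable R (boundary Y)) :
  (exists F : morphism X Y,
     boundary_values F =1 phi /\ coarse_map (inner_map F)) /\
  (forall F G : morphism X Y,
     boundary_values F =1 phi -> boundary_values G =1 phi ->
     close_morphisms F G).
Proof.
split; last by move=> F G Fphi Gphi z; rewrite Fphi Gphi.
have [F [Fphi bF]] := boundary_map_extends hne hphi hmetr.
exists F; split=> //; split; first exact: morphism_proper.
exact: locally_bounded_controlled.
Qed.
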